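(* Let $X$ be a discrete random variable taking values in $\{0, 1, 2, \ldots\}$ with finite expectation and decreasing density, that is, $\mathbb{P}(X = i + 1) \leq \mathbb{P}(X = i)$ for all $i \in \{0, 1, 2, \ldots\}$. Then for all $a \in \{1, 2, \ldots\}$, $$\mathbb{P}(X \geq a) \leq \frac{\mathbb{E}(X)}{2a - 1}.$$ This inequality is tight in the sense that for each $a \in \{1,2,\ldots\}$ there exists a random variable $X$ over the nonnegative integers with unimodal density such that $\mathbb{P}(X \geq a) = \mathbb{E}(X)/(2a - 1)$.
   Context: The density of an integer-valued random variable $X$ (with respect to counting measure) is the function $i \mapsto \mathbb{P}(X = i)$ on the integers. The density is unimodal if there exists an integer $m$ such that $\mathbb{P}(X = i + 1) \leq \mathbb{P}(X = i)$ for all integers $i \geq m$ and $\mathbb{P}(X = i - 1) \leq \mathbb{P}(X = i)$ for all integers $i \leq m$. *)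

(* Defs.v *)
From HB Require Import structures.
From mathcomp Require Export all_boot all_order all_algebra.
From mathcomp Require Export all_classical all_reals all_analysis.

Set Implicit Arguments.
Unset Strict Implicit.
Unset Printing Implicit Defensive.

Import Order.TTheory GRing.Theory Num.Theory.

Local Open Scope ring_scope.

(* The density of X with respect to counting measure on the integers; an
   integer-valued random variable is represented as a real-valued one. *)
Definition int_density (R : realType) (d : measure_display)
    (T : measurableType d) (P : probability T R) (X : {dRV P >-> R})
    (i : int) : R :=
  @pmf d T R P X i%:~R.

Definition unimodal (R : realType) (f : int -> R) : Prop :=
  exists m : int,
    (forall i : int, m <= i -> f (i + 1) <= f i) /\
    (forall i : int, i <= m -> f (i - 1) <= f i).

(* Main.v *)
(* Reflect {0, ..., a-1} onto {a, ..., 2a-1} by k |-> 2a-1-k.  Pointwise,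
     (2a-1) 1[X >= a] + sum_(k < a) k 1[X = k]
       <= X + sum_(k < a) k 1[X = 2a-1-k],
   and taking expectations gives the bound, since P(X = 2a-1-k) <= P(X = k) for
   k < a when the density is decreasing.  Equality holds for the uniform
   distribution on {0, ..., 2a-1}, where both sides are 1/2. *)
Require Import Defs.
From HB Require Import structures.
From mathcomp Require Import all_boot all_order all_algebra.
From mathcomp Require Import all_classical all_reals all_analysis.
From mathcomp Require Import measurable_realfun.
From mathcomp Require Import zify ring lra.

Import Order.TTheory GRing.Theory Num.Theory.

Local Open Scope classical_set_scope.
Local Open Scope ring_scope.

(** * Finite sums of naturals and the reflection inequality *)

Lemma sum_nat_delta (a : nat) (F : nat -> nat) (j : nat) :
  (\sum_(k < a) F k * (j == k) = F j * (j < a))%N.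
Proof.
have [ja|aj] := ltnP j a.
  rewrite (bigD1 (Ordinal ja))//= eqxx !muln1 big1 ?addn0// => k kj.
  by rewrite (_ : (j == k) = false) ?muln0//; apply/negbTE; rewrite eq_sym.
rewrite muln0 big1// => k _.
by rewrite (_ : (j == k) = false) ?muln0//; have := ltn_ord k; lia.
Qed.

Lemma sum_nat_geq (a n : nat) : (\sum_(k < n) (a <= k) = n - a)%N.
Proof. by elim: n => [|n IH]; rewrite ?big_ord0// big_ord_recr/= IH; lia. Qed.

(** Gauss's sum, doubled so that no division occurs in [nat]. *)
Lemma sum_ord_id (n : nat) : (2 * \sum_(k < n) k = n * n.-1)%N.
Proof. by elim: n => [|n IH]; rewrite ?big_ord0// big_ord_recr/= mulnDr IH; nia. Qed.

(** Three ranges of [j]. Below [a], the left side is just [j]. For a <= j < 2a, the index k = 2a-1-j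
    lies below [a] and its weight lifts [j] to exactly 2a-1. From 2a on, [j] alone exceeds 2a-1. *)
Lemma sum_reflected_weights (a j : nat) :
  ((2 * a - 1) * (a <= j) + \sum_(k < a) k * (j == k)
   <= j + \sum_(k < a) k * (j == 2 * a - 1 - k))%N.
Proof.
rewrite (sum_nat_delta a id).
have [ja|aj] := ltnP j a; first by rewrite muln0 muln1 leq_addr.
rewrite muln0 addn0 muln1; have [j2a|] := ltnP j (2 * a); last by lia.
have ka : (2 * a - 1 - j < a)%N by lia.
rewrite (bigD1 (Ordinal ka))//= (_ : (j == _) = true); last by lia.
by lia.
Qed.

(** * Integration of finite combinations of indicators *)

Lemma integral_sum_indic (d : measure_display) (T : measurableType d)
    (R : realType) (mu : {measure set T -> \bar R}) (n : nat)
    (c : 'I_n -> R) (A : 'I_n -> set T) :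
  (forall k, 0 <= c k) -> (forall k, measurable (A k)) ->
  (\int[mu]_t (\sum_(k < n) c k * \1_(A k) t)%:E
   = \sum_(k < n) (c k)%:E * mu (A k))%E.
Proof.
move=> c0 mA.
have mc k : measurable_fun setT (fun t => (c k * \1_(A k) t)%:E).
  by apply/measurable_EFinP; exact: measurable_funM.
under eq_integral do rewrite -sumEFin.
rewrite ge0_integral_sum//; last first.
  by move=> k t _; rewrite lee_fin mulr_ge0.
apply: eq_bigr => k _; under eq_integral do rewrite EFinM.
rewrite ge0_integralZl_EFin//; last first.
  by apply/measurable_EFinP.
by rewrite integral_indic// setIT.
Qed.

Lemma measurable_fun_sum_indic (d : measure_display) (T : measurableType d)
    (R : realType) (n : nat) (c : 'I_n -> R) (A : 'I_n -> set T) :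
  (forall k, measurable (A k)) ->
  measurable_fun setT (fun t => \sum_(k < n) c k * \1_(A k) t).
Proof.
move=> mA; apply: measurable_sum => k.
by apply: measurable_funM => //; exact: measurable_indic.
Qed.

(** * The tail bound for a decreasing density *)

Section decreasing_density.
Context (R : realType) (d : measure_display) (T : measurableType d)
  (P : probability T R) (X : {dRV P >-> R})
  (X_nat : forall t, X t \is a Num.nat).

Lemma measurable_level_set (r : R) : measurable (X @^-1` [set r]).
Proof. by rewrite -[X in measurable X]setTI; exact: measurable_funP. Qed.

Lemma measurable_tail_set (r : R) : measurable [set t | r <= X t].
Proof.
rewrite (_ : mkset _ = X @^-1` `[r, +oo[); last first.
  by apply/seteqP; split=> t /=; rewrite in_itv/= andbT.
by rewrite -[X in measurable X]setTI; exact: measurable_funP.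
Qed.

Lemma int_densityE (i : nat) :
  ((int_density X i%:Z)%:E = P (X @^-1` [set i%:R]))%E.
Proof. by rewrite /int_density /pmf /= pmulrn fineK// fin_num_measure. Qed.

(** As [X t] is a natural number [j], each indicator is the truth value of a condition on [j], and
    the claim becomes [sum_reflected_weights] cast into [R]. *)
Lemma reflected_weights_le (a : nat) (t : T) : (0 < a)%N ->
  (2 * a%:R - 1) * \1_[set t | a%:R <= X t] t
    + \sum_(k < a) k%:R * \1_(X @^-1` [set k%:R]) t
  <= X t + \sum_(k < a) k%:R * \1_(X @^-1` [set (2 * a - 1 - k)%:R]) t.
Proof.
move=> a0; have /natrP[j Xj] := X_nat t.
have indE (i : nat) : \1_(X @^-1` [set i%:R]) t = (j == i)%:R :> R.
  rewrite indicE (_ : (t \in _) = (j == i))//.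
  apply/idP/idP; rewrite inE/= Xj; first by move/eqP; rewrite eqr_nat.
  by move/eqP ->.
under eq_bigr do rewrite indE -natrM.
under [X in _ <= _ + X]eq_bigr do rewrite indE -natrM.
rewrite indicE (_ : (t \in _) = (a <= j)%N); last first.
  by apply/idP/idP; rewrite ?inE/= Xj ler_nat.
(* Positivity of [a] makes truncated and real subtraction agree here. *)
rewrite -!natr_sum Xj (_ : 2 * a%:R - 1 = (2 * a - 1)%:R); last first.
  by rewrite natrB ?natrM//; lia.
by rewrite -natrM -!natrD ler_nat sum_reflected_weights.
Qed.

(** One-step decrease is chained because the bound compares the density at the distant points k and
    2a-1-k. *)
Lemma int_density_le :
  (forall i : nat, int_density X i.+1%:Z <= int_density X i%:Z) ->
  forall i j : nat, (i <= j)%N -> int_density X j%:Z <= int_density X i%:Z.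
Proof.
by move=> dec i j; apply: (@nonincreasing_seqP _ _ (fun n : nat => int_density X n%:Z)).1.
Qed.

Lemma tail_bound_decreasing_density (a : nat) : (0 < a)%N ->
  (forall i : nat, int_density X i.+1%:Z <= int_density X i%:Z) ->
  ((2 * a%:R - 1)%:E * P [set t | a%:R <= X t]%R <= 'E_P[X])%E.
Proof.
move=> a0 dec.
have a1 : 1 <= a%:R :> R by rewrite ler1n.
have c_ge0 : 0 <= 2 * a%:R - 1 :> R by lra.
pose tail (t : T) : R := (2 * a%:R - 1) * \1_[set t | a%:R <= X t] t.
(* The map [s] lets one definition serve both weighted sums: [s = id] on the left, [s = refl] on the
   right. *)
pose levels (s : nat -> nat) (t : T) : R :=
  \sum_(k < a) k%:R * \1_(X @^-1` [set (s k)%:R]) t.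
pose refl k := (2 * a - 1 - k)%N.
have integral_levels s : (\int[P]_t (levels s t)%:E
     = (\sum_(k < a) k%:R * int_density X (s k)%:Z)%:E)%E.
  rewrite integral_sum_indic//.
  by rewrite -sumEFin; apply: eq_bigr => k _; rewrite EFinM int_densityE.
have mlevels s : measurable_fun setT (fun t => (levels s t)%:E).
  apply/measurable_EFinP; apply: measurable_fun_sum_indic => k.
  exact: measurable_level_set.
have levels_ge0 s t : (0 <= (levels s t)%:E)%E.
  by rewrite lee_fin sumr_ge0// => k _; rewrite mulr_ge0.
have mind : measurable_fun setT (\1_[set t | a%:R <= X t] : T -> R).
  by apply: measurable_indic; exact: measurable_tail_set.
have mtail : measurable_fun setT (fun t => (tail t)%:E).
  by apply/measurable_EFinP; exact: measurable_funM.
have tail_ge0 t : (0 <= (tail t)%:E)%E by rewrite lee_fin mulr_ge0.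
have X_ge0 t : (0 <= (X t)%:E)%E by rewrite lee_fin natr_ge0.
have mX : measurable_fun setT (fun t => (X t)%:E) by apply/measurable_EFinP.
have : (\int[P]_t ((tail t)%:E + (levels id t)%:E)
    <= \int[P]_t ((X t)%:E + (levels refl t)%:E))%E.
  apply: ge0_le_integral => //.
  - by move=> t _; exact: adde_ge0.
  - exact: emeasurable_funD.
  - exact: emeasurable_funD.
  - by move=> t _; rewrite -!EFinD lee_fin reflected_weights_le.
rewrite !ge0_integralD// !integral_levels -expectation_def.
under eq_integral do rewrite EFinM.
rewrite ge0_integralZl_EFin//; last exact/measurable_EFinP.
rewrite integral_indic ?setIT//; last exact: measurable_tail_set.
(* The integrated level sums are finite reals, so they may be moved across an inequality in
   [\bar R]. What remains is a termwise comparison, valid since k <= 2a-1-k for k < a. *)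
rewrite -leeBrDr// => /le_trans; apply.
rewrite leeBlDr// leeD2l// lee_fin ler_sum// => k _.
rewrite ler_wpM2l// int_density_le// /refl.
by have := ltn_ord k; lia.
Qed.

End decreasing_density.

(** * The uniform distribution, which attains the bound *)

Section uniform_nat.
Context (R : realType) (n : nat).

(* The support is {0, ..., n}: n+1 points. *)
Definition uniform_nat : set nat -> \bar R :=
  mscale (n.+1%:R^-1)%:nng (msum (fun k : nat => \d_k) n.+1).

HB.instance Definition _ := Measure.on uniform_nat.

Lemma uniform_natE (A : set nat) :
  uniform_nat A = (n.+1%:R^-1 * \sum_(k < n.+1) ((k : nat) \in A)%:R)%:E.
Proof. by rewrite /uniform_nat /mscale EFinM -sumEFin. Qed.

Let uniform_nat_setT : uniform_nat setT = 1%E.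
Proof.
rewrite uniform_natE; under eq_bigr do rewrite in_setT.
by rewrite sumr_const card_ord mulVf.
Qed.

HB.instance Definition _ :=
  Measure_isProbability.Build _ _ R uniform_nat uniform_nat_setT.

(** The extremal random variable: random variables are real-valued here, so the sample point is
    embedded in [R]. *)
Definition natr_fun (k : nat) : R := k%:R.

Let measurable_natr_fun : measurable_fun setT natr_fun.
Proof. by []. Qed.

HB.instance Definition _ :=
  isMeasurableFun.Build _ _ nat R natr_fun measurable_natr_fun.

Let countable_range_natr_fun : countable (range natr_fun).
Proof. exact: (card_le_trans (card_image_le _ _)). Qed.

HB.instance Definition _ :=
  MeasurableFun_isDiscrete.Build _ _ nat R natr_fun countable_range_natr_fun.

End uniform_nat.

(** For nonnegative [f] the integral is additive in the measure and commutes with scaling it; each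
    Dirac mass contributes [f k]. *)
Lemma uniform_nat_expectation (R : realType) (n : nat) (f : nat -> R) :
  (forall k, 0 <= f k) ->
  ('E_(uniform_nat R n)[f] = (n.+1%:R^-1 * \sum_(k < n.+1) f k)%:E)%E.
Proof.
move=> f0; rewrite unlock ge0_integral_mscale//; last by move=> k _; rewrite lee_fin.
rewrite ge0_integral_measure_sum//; last by move=> k _; rewrite lee_fin.
rewrite EFinM -sumEFin; congr (_ * _)%E; apply: eq_bigr => k _.
by rewrite integral_dirac// diracT mul1e.
Qed.

Lemma int_density_uniform (R : realType) (n : nat) (i : int) :
  @int_density R _ _ (uniform_nat R n) (natr_fun R) i
  = n.+1%:R^-1 * ((0 <= i) && (i <= n%:Z))%:R.
Proof.
rewrite /int_density /pmf [X in fine X]uniform_natE /=; congr (_ * _).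
under eq_bigr => k _.
  rewrite (_ : (_ \in _) = (k%:Z == i)); last first.
    apply/idP/idP; rewrite inE/= /natr_fun pmulrn; first by move/intr_inj => ->.
    by move/eqP ->.
  over.
(* A nonnegative [i] matches one term of the sum exactly when i <= n; a negative one matches
   none. *)
case: i => i /=.
  rewrite -natr_sum; congr (_%:R).
  under eq_bigr do rewrite -[X in nat_of_bool X]/(_ == i)%N eq_sym -[nat_of_bool _]mul1n.
  by rewrite (sum_nat_delta _ (fun=> 1%N)) mul1n ltnS.
by rewrite big1.
Qed.

Lemma unimodal_int_density_uniform (R : realType) (n : nat) :
  unimodal (@int_density R _ _ (uniform_nat R n) (natr_fun R)).
Proof.
(* With mode 0, the density vanishes to the left, and to the right it is constant up to [n] and then
   zero. *)
exists 0; split=> i i0; rewrite !int_density_uniform ler_wpM2l// ler_nat;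
  by case: (boolP (_ && _)) => //; lia.
Qed.

Theorem theorem2 (R : realType) :
  (forall (d : measure_display) (T : measurableType d) (P : probability T R)
          (X : {dRV P >-> R}),
     (forall t : T, X t \is a Num.nat) ->
     ('E_P[X])%E \is a fin_num ->
     (forall i : nat, int_density X i.+1%:Z <= int_density X i%:Z) ->
     forall a : nat, (1 <= a)%N ->
       (P [set t | (a%:R <= X t)%R] <= 'E_P[X] / (2 * a%:R - 1)%:E)%E)
  /\
  (forall a : nat, (1 <= a)%N ->
     exists (d : measure_display) (T : measurableType d) (P : probability T R)
            (X : {dRV P >-> R}),
       (forall t : T, X t \is a Num.nat) /\
       unimodal (int_density X) /\
       (P [set t | (a%:R <= X t)%R] = 'E_P[X] / (2 * a%:R - 1)%:E)%E).
Proof.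
split.
  move=> d T P X X_nat _ dec a a0.
  have a1 : 1 <= a%:R :> R by rewrite ler1n.
  have c0 : 0 < 2 * a%:R - 1 :> R by lra.
  (* The inverse in [\bar R] is the real inverse only away from 0, hence the appeal to 2a-1 > 0. *)
  rewrite inver gt_eqF// lee_pdivlMr//.
  by rewrite muleC tail_bound_decreasing_density.
move=> a a0; have a1 : 1 <= a%:R :> R by rewrite ler1n.
(* The parameter is the largest support point, so the predecessor yields the 2a points 0, ..., 2a-1,
   of which [a] lie in the tail. *)
exists _, nat, (uniform_nat R (2 * a).-1), (natr_fun R).
split; first by move=> k; exact: natr_nat.
split; first exact: unimodal_int_density_uniform.
have aE : (2 * a).-1.+1 = (2 * a)%N by lia.
rewrite uniform_nat_expectation => [|k]; last exact: ler0n.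
rewrite [LHS]uniform_natE aE.
under eq_bigr => k _.
  rewrite (_ : (_ \in _) = (a <= k)%N); last first.
    by apply/idP/idP; rewrite inE/= /natr_fun ler_nat.
  over.
rewrite /natr_fun -!natr_sum sum_nat_geq.
rewrite (_ : \sum_(k < 2 * a) k = a * (2 * a - 1))%N; last first.
  by have := sum_ord_id (2 * a); nia.
have c0 : 0 < 2 * a%:R - 1 :> R by lra.
rewrite inver gt_eqF// -EFinM.
(* The tail count is 2a - a = a and the values sum to a(2a-1); both are divided by 2a, and the
   factor 2a-1 cancels. *)
congr (_%:E); rewrite mul2n -addnn addnK natrM natrB ?natrD; last lia.
by field; apply/andP; split; rewrite gt_eqF//; lra.
Qed.
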